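(* Let $f=\frac1n\sum_{i=1}^n f_i$. Assume that $f$ satisfies the Polyak-Lojasiewicz (PL) condition with constant $\mu>0$, that is, $$\|\nabla f(x)\|^2\ge 2\mu\,(f(x)-f^* )\quad\text{for all }x\in\mathbb{R}^d,$$ and let $f$ and the $f_i$ be smooth functions (the $f_i$ are not assumed convex), with smoothness constants $L$ and $L_i$ respectively, and $L_{\max}=\max\{L_i\}_{i=1}^n$. Then SGD with $\text{SPS}_{\max}$ with $c>\frac{L_{\max}}{4\mu}$ and $\gamma_b\ge\frac{1}{2cL_{\max}}$ converges as $$\mathbb{E}[f(x^k)-f(x^* )]\le\nu^k\,[f(x^0)-f(x^* )]+\frac{L\sigma^2\gamma_b}{2(1-\nu)\,c},$$ where $\nu=\gamma_b\left(\frac1\alpha-2\mu+\frac{L_{\max}}{2c}\right)\in(0,1]$ and $\alpha=\min\left\{\frac{1}{2cL_{\max}},\gamma_b\right\}$.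
   Context: The problem is to minimize $f(x)=\frac1n\sum_{i=1}^n f_i(x)$ over $x\in\mathbb{R}^d$. The set of minimizers of $f$ is assumed nonempty, $x^*$ is a minimizer and $f^*=f(x^* )$ is the minimum value. For each $i$, $f_i^*:=\inf_x f_i(x)$. It is assumed throughout that the optimal objective difference $\sigma^2:=\mathbb{E}_i[f_i(x^* )-f_i^*]=f(x^* )-\mathbb{E}_i[f_i^*]$ is finite, where $\mathbb{E}_i$ is expectation over $i$ uniform in $\{1,\dots,n\}$. A function is smooth with constant $L$ ($L$-smooth) if its gradient is $L$-Lipschitz. SGD: $x^{k+1}=x^k-\gamma_k\nabla f_i(x^k)$, starting from $x^0$, where at each iteration $k$ the index $i\in\{1,\dots,n\}$ is chosen uniformly at random and $\gamma_k>0$ is the step-size. $\text{SPS}_{\max}$ (bounded stochastic Polyak step-size) with parameters $c>0$ and $\gamma_b>0$: $\gamma_k=\min\left\{\frac{f_i(x^k)-f_i^*}{c\,\|\nabla f_i(x^k)\|^2},\,\gamma_b\right\}$, where $i$ is the index chosen at iteration $k$.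
   Formalization: The condition ν ∈ (0,1] is taken as an assumption on the parameters: it does not follow from the bounds on c and γ_b, since ν exceeds 1 for large γ_b and the stated bound can then fail. *)

(* Defs.v *)
From HB Require Import structures.
From mathcomp Require Import all_boot all_order all_algebra.
From mathcomp Require Import all_classical all_reals all_analysis.
Set Implicit Arguments.
Unset Strict Implicit.
Unset Printing Implicit Defensive.
Import Order.TTheory GRing.Theory Num.Theory.
Import numFieldNormedType.Exports.
Local Open Scope classical_set_scope.
Local Open Scope ring_scope.

(* The library norm on 'rV[R]_d is the sup norm; ||.|| is the Euclidean one. *)
Definition enorm (R : realType) (d : nat) (x : 'rV[R]_d) : R :=
  Num.sqrt (\sum_(j < d) x 0 j ^+ 2).

Definition grad (R : realType) (d : nat) (g : 'rV[R]_d -> R) (x : 'rV[R]_d) :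
    'rV[R]_d :=
  \row_j 'D_(delta_mx 0 j) g x.

Definition smooth (R : realType) (d : nat) (L : R) (g : 'rV[R]_d -> R) : Prop :=
  (forall x, differentiable g x) /\
  (forall x y, enorm (grad g x - grad g y) <= L * enorm (x - y)).

Definition favg (R : realType) (d n : nat) (f : 'I_n -> 'rV[R]_d -> R)
    (x : 'rV[R]_d) : R :=
  n%:R^-1 * \sum_(i < n) f i x.

Definition is_minimizer (R : realType) (d : nat) (g : 'rV[R]_d -> R)
    (xs : 'rV[R]_d) : Prop :=
  forall x, g xs <= g x.

Definition polyak_lojasiewicz (R : realType) (d : nat) (mu : R)
    (g : 'rV[R]_d -> R) (gstar : R) : Prop :=
  forall x, 2 * mu * (g x - gstar) <= enorm (grad g x) ^+ 2.

(* Extended-real infimum, equal to -oo when g is unbounded below. *)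
Definition finf (R : realType) (d : nat) (g : 'rV[R]_d -> R) : \bar R :=
  ereal_inf (range (fun x => (g x)%:E)).

(* sigma^2; it is +oo as soon as one f_i is unbounded below. *)
Definition sigma2 (R : realType) (d n : nat) (f : 'I_n -> 'rV[R]_d -> R)
    (xs : 'rV[R]_d) : \bar R :=
  ((n%:R^-1)%:E * \sum_(i < n) ((f i xs)%:E - finf (f i)))%E.

(* The quotient is undefined when the gradient vanishes; the step-size is then
   taken to be gamma_b. The SGD update does not depend on that choice.
   [fine] is the identity on finite values, and finf g is finite for each g = f_i
   when sigma2 is. *)
Definition sps_max (R : realType) (d : nat) (c gammab : R)
    (g : 'rV[R]_d -> R) (x : 'rV[R]_d) : R :=
  if grad g x == 0 then gammab
  else Num.min ((g x - fine (finf g)) / (c * enorm (grad g x) ^+ 2)) gammab.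

Fixpoint sgd (R : realType) (d n : nat) (f : 'I_n -> 'rV[R]_d -> R)
    (c gammab : R) (x0 : 'rV[R]_d) (idx : nat -> 'I_n) (k : nat) : 'rV[R]_d :=
  if k is k'.+1 then
    let x := sgd f c gammab x0 idx k' in
    let g := f (idx k') in
    x - sps_max c gammab g x *: grad g x
  else x0.

Definition uniform_index (R : realType) (disp : measure_display)
    (T : measurableType disp) (P : probability T R) (n : nat)
    (I : T -> 'I_n) : Prop :=
  forall i, measurable (I @^-1` [set i]) /\
            P (I @^-1` [set i]) = (n%:R^-1)%:E.

Definition mutually_independent (R : realType) (disp : measure_display)
    (T : measurableType disp) (P : probability T R) (n : nat)
    (I : nat -> T -> 'I_n) : Prop :=
  forall (J : seq nat) (A : nat -> set 'I_n), uniq J ->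
    P (\bigcap_(k in [set` J]) (I k @^-1` A k)) =
    (\prod_(k <- J) P (I k @^-1` A k))%E.

(* Main.v *)
Require Import Defs.
From HB Require Import structures.
From mathcomp Require Import all_boot all_order all_algebra.
From mathcomp Require Import all_classical all_reals all_analysis.
From mathcomp Require Import ring lra.
Set Implicit Arguments.
Unset Strict Implicit.
Unset Printing Implicit Defensive.
Import Order.TTheory GRing.Theory Num.Theory.
Import numFieldNormedType.Exports.
Local Open Scope classical_set_scope.
Local Open Scope ring_scope.

(** Write [F] for [favg f], [e x = F x - F xs], [m_i] for the infimum of [f i] and
    [g_i] for its gradient at [x]. A smooth function lies below its quadratic
    upper bound ([smooth_quad_upper]); applied to [F] with constant [M] at a step
    [- ga_i g_i], this gives
      [e (x - ga_i g_i) <= e x - ga_i <grad F x, g_i> + M / 2 ga_i^2 |g_i|^2].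
    The Polyak step satisfies [ga_i c |g_i|^2 <= f_i x - m_i]
    ([sps_max_sqr_enorm_le]) and [alpha <= ga_i <= gammab]; the lower bound
    [le_sps_max] comes from [|g_i|^2 <= 2 Lmax (f_i x - m_i)]
    ([sqr_enorm_grad_le]). Since [e >= 0], dividing by [ga_i] yields ([step_gap_le])
      [e (x - ga_i g_i) <= gammab (e x / alpha - <grad F x, g_i>
                                   + M / (2 c) (f_i x - m_i))].
    The average over [i] of the inner products is [|grad F x|^2], at least
    [2 mu e x] by the Polyak-Lojasiewicz condition, and the average of
    [f_i x - m_i] is [e x + sigma2] ([mean_sgd_step_le]).

    The contraction factor requires [M <= Lmax] and the noise requires
    [M sigma2 <= L sigma2]. Both [L] and [Lmax] are admissible constants for [F], so
    [M] is the smaller one, truncated at 0; when [L < 0] the space is a point and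
    [sigma2 = 0] ([sigma2_lt0_smooth]).

    The first [k] indices are uniform on the [k]-tuples ([expectation_prefix]), so
    the expectation of [e] along the iterates is a finite average, and the
    one-step bound iterates to [nu^k e x0] plus a geometric sum
    ([expectation_sgd_le], [geometric_noise_le]). *)

(** * Euclidean inner product *)

(** The Euclidean inner product, whose norm is [enorm]. *)
Definition edot (R : realType) (d : nat) (x y : 'rV[R]_d) : R :=
  \sum_(j < d) x 0 j * y 0 j.

Lemma edotC (R : realType) (d : nat) (x y : 'rV[R]_d) : edot x y = edot y x.
Proof. by apply: eq_bigr => j _; rewrite mulrC. Qed.

Lemma edotDl (R : realType) (d : nat) (x y z : 'rV[R]_d) :
  edot (x + y) z = edot x z + edot y z.
Proof.
by rewrite /edot -big_split; apply: eq_bigr => j _; rewrite mxE mulrDl.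
Qed.

Lemma edotZl (R : realType) (d : nat) (a : R) (x y : 'rV[R]_d) :
  edot (a *: x) y = a * edot x y.
Proof. by rewrite mulr_sumr; apply: eq_bigr => j _; rewrite mxE mulrA. Qed.

Lemma edotDr (R : realType) (d : nat) (x y z : 'rV[R]_d) :
  edot x (y + z) = edot x y + edot x z.
Proof. by rewrite edotC edotDl !(edotC x). Qed.

Lemma edotZr (R : realType) (d : nat) (a : R) (x y : 'rV[R]_d) :
  edot x (a *: y) = a * edot x y.
Proof. by rewrite edotC edotZl (edotC x). Qed.

Lemma edotBl (R : realType) (d : nat) (x y z : 'rV[R]_d) :
  edot (x - y) z = edot x z - edot y z.
Proof. by rewrite edotDl -scaleN1r edotZl mulN1r. Qed.

Lemma edotxx_ge0 (R : realType) (d : nat) (x : 'rV[R]_d) : 0 <= edot x x.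
Proof. by apply: sumr_ge0 => j _; rewrite -expr2 sqr_ge0. Qed.

Lemma enorm_ge0 (R : realType) (d : nat) (x : 'rV[R]_d) : 0 <= enorm x.
Proof. exact: sqrtr_ge0. Qed.

Lemma sqr_enorm (R : realType) (d : nat) (x : 'rV[R]_d) :
  enorm x ^+ 2 = edot x x.
Proof. by rewrite sqr_sqrtr ?sumr_ge0// => j _; rewrite sqr_ge0. Qed.

Lemma enorm_gt0 (R : realType) (d : nat) (x : 'rV[R]_d) :
  x != 0 -> 0 < enorm x.
Proof.
move=> x0; rewrite lt_neqAle enorm_ge0 andbT eq_sym; apply: contra_neq x0 => x0.
have := sqr_enorm x; rewrite x0 expr0n/= => /esym/eqP.
rewrite psumr_eq0 => [/allP xj0|j _]; last by rewrite -expr2 sqr_ge0.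
apply/rowP => j; have := xj0 j (mem_index_enum _).
by rewrite mulf_eq0 orbb mxE => /eqP.
Qed.

Lemma enorm0 (R : realType) (d : nat) : enorm (0 : 'rV[R]_d) = 0.
Proof. by rewrite /enorm big1 ?sqrtr0// => j _; rewrite mxE expr0n. Qed.

Lemma enormZ (R : realType) (d : nat) (a : R) (x : 'rV[R]_d) :
  enorm (a *: x) = `|a| * enorm x.
Proof.
rewrite -sqrtr_sqr -sqrtrM ?sqr_ge0// /enorm mulr_sumr.
by congr Num.sqrt; apply: eq_bigr => j _; rewrite mxE exprMn.
Qed.

(** Cauchy-Schwarz, from the nonnegativity of the squared norm of
    [<y, y> x - <x, y> y]. *)
Lemma edot_le_enorm (R : realType) (d : nat) (x y : 'rV[R]_d) :
  edot x y <= enorm x * enorm y.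
Proof.
have [->|y0] := eqVneq y 0.
  by rewrite enorm0 mulr0 /edot big1// => j _; rewrite mxE mulr0.
have Y0 : 0 < edot y y by rewrite -sqr_enorm exprn_gt0// enorm_gt0.
have := edotxx_ge0 (edot y y *: x + (- edot x y) *: y).
rewrite !(edotDl, edotDr, edotZl, edotZr) (edotC y x) => h.
have {}h : 0 <= edot y y * (edot x x * edot y y - edot x y ^+ 2).
  by apply: le_trans h _; rewrite le_eqVlt; apply/orP; left; apply/eqP; ring.
rewrite pmulr_rge0// subr_ge0 -!sqr_enorm -exprMn in h.
have [xy0|xy0] := ltP (edot x y) 0.
  by rewrite (le_trans (ltW xy0))// mulr_ge0 ?enorm_ge0.
by rewrite -ler_sqr ?nnegrE ?mulr_ge0 ?enorm_ge0.
Qed.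

(** * Gradients and the descent lemma *)

Lemma derive_edot_grad (R : realType) (d : nat) (g : 'rV[R]_d -> R)
    (x v : 'rV[R]_d) :
  differentiable g x -> 'D_v g x = edot (grad g x) v.
Proof.
move=> dg; rewrite deriveE// {1}(row_sum_delta v) linear_sum.
by apply: eq_bigr => j _; rewrite linearZ mxE deriveE// mulrC.
Qed.

Lemma is_derive_line (R : realType) (d : nat) (g : 'rV[R]_d -> R)
    (x v : 'rV[R]_d) (t : R) :
  differentiable g (x + t *: v) ->
  is_derive t (1 : R) (fun s : R => g (x + s *: v))
    (edot (grad g (x + t *: v)) v).
Proof.
move=> dg.
have E : (fun e : R => e^-1 *: (((fun s : R => g (x + s *: v)) \o shift t) (e *: 1)
            - g (x + t *: v)))
       = (fun e : R => e^-1 *: ((g \o shift (x + t *: v)) (e *: v)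
            - g (x + t *: v))).
  apply/funext => e /=; congr (_ *: (g _ - _)).
  by rewrite [e *: 1]mulr1 scalerDl addrCA.
apply: DeriveDef.
  by rewrite /derivable /= E; exact: diff_derivable.
by rewrite -derive_edot_grad// /derive E.
Qed.

(** The quadratic upper bound implied by an [M]-Lipschitz gradient; being an
    inequality between functions, it passes to averages term by term. *)
Definition quad_upper (R : realType) (d : nat) (M : R) (g : 'rV[R]_d -> R) :=
  forall x v, g (x + v) <= g x + edot (grad g x) v + M / 2 * enorm v ^+ 2.

(** The descent lemma: along the segment, the difference of the two sides is a
    nonincreasing function of the parameter. *)
Lemma smooth_quad_upper (R : realType) (d : nat) (M : R) (g : 'rV[R]_d -> R) :
  smooth M g -> quad_upper M g.
Proof.
move=> [dg lg] x v.
pose psi (t : R) := g (x + t *: v) - t * edot (grad g x) v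
                    - t ^+ 2 * (M / 2 * enorm v ^+ 2).
pose dpsi (t : R) := edot (grad g (x + t *: v)) v - edot (grad g x) v
                     - t * (M * enorm v ^+ 2).
have dpsiP (t : R) : is_derive t (1 : R) psi (dpsi t).
  have dl := is_derive_line (dg (x + t *: v)).
  rewrite /psi; apply: is_derive_eq.
  rewrite /dpsi /GRing.scale/= !(mulr1, mulr0, add0r, addr0).
  by field.
have cpsi : {within `[0, 1], continuous psi}.
  by apply: derivable_within_continuous => t _; case: (dpsiP t).
have [t /[!in_itv]/= /andP[t0 t1]] :=
  MVT (@ltr01 R) (fun t _ => dpsiP t) cpsi.
rewrite subr0 mulr1 /psi scale1r scale0r addr0 expr1n expr0n/= !mul1r !mul0r !subr0.
have : dpsi t <= 0.
  rewrite /dpsi -edotBl subr_le0 (le_trans (edot_le_enorm _ _))//.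
  have := lg (x + t *: v) x; rewrite addrAC subrr add0r enormZ gtr0_norm// => h.
  have := ler_wpM2r (enorm_ge0 v) h.
  by move/le_trans; apply; rewrite le_eqVlt; apply/orP; left; apply/eqP; ring.
by move=> + e; rewrite -e; lra.
Qed.

Lemma edot_grad_favg (R : realType) (d n : nat) (f : 'I_n -> 'rV[R]_d -> R)
    (x v : 'rV[R]_d) :
  (forall i, differentiable (f i) x) ->
  edot (grad (favg f) x) v = n%:R^-1 * \sum_(i < n) edot (grad (f i) x) v.
Proof.
move=> df; rewrite exchange_big mulr_sumr; apply: eq_bigr => j _ /=.
have -> : favg f = n%:R^-1 \*: (\sum_(i < n) f i).
  by apply/funext => y; rewrite /favg /= fct_sumE.
have dj i : derivable (f i) x (delta_mx 0 j) by exact: diff_derivable.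
rewrite mxE deriveZ ?derive_sum//; last exact: derivable_sum.
rewrite -[_ *: _]/(_ * _) -mulrA mulr_suml; congr (_ * _).
by apply: eq_bigr => i _; rewrite mxE.
Qed.

Lemma quad_upper_le (R : realType) (d : nat) (M M' : R) (g : 'rV[R]_d -> R) :
  M <= M' -> quad_upper M g -> quad_upper M' g.
Proof.
move=> MM' qg x v; apply: (le_trans (qg x v)).
by rewrite lerD2l ler_wpM2r ?sqr_ge0// ler_pM2r ?invr_gt0.
Qed.

Lemma quad_upper_favg (R : realType) (d n : nat) (M : R)
    (f : 'I_n.+1 -> 'rV[R]_d -> R) :
  (forall i x, differentiable (f i) x) -> (forall i, quad_upper M (f i)) ->
  quad_upper M (favg f).
Proof.
move=> df qf x v; rewrite edot_grad_favg// /favg.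
have n0 : n.+1%:R != 0 :> R by rewrite pnatr_eq0.
rewrite -[M / 2 * _](mulKf n0) -!mulrDr ler_wpM2l ?invr_ge0//.
have -> : n.+1%:R * (M / 2 * enorm v ^+ 2)
          = \sum_(i < n.+1) M / 2 * enorm v ^+ 2.
  by rewrite sumr_const card_ord mulr_natl.
by rewrite -!big_split/= ler_sum// => i _; exact: qf.
Qed.

(** * Infima and the Polyak step-size *)

Lemma finf_le (R : realType) (d : nat) (g : 'rV[R]_d -> R) (x : 'rV[R]_d) :
  (finf g <= (g x)%:E)%E.
Proof. by apply: ereal_inf_lbound; exists x. Qed.

Lemma fine_finf_le (R : realType) (d : nat) (g : 'rV[R]_d -> R)
    (x : 'rV[R]_d) :
  finf g \is a fin_num -> fine (finf g) <= g x.
Proof. by move=> fg; rewrite -lee_fin fineK// finf_le. Qed.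

(** Minimizing the quadratic upper bound over the step, at [- M^-1 *: grad g x]. *)
Lemma sqr_enorm_grad_le (R : realType) (d : nat) (M : R) (g : 'rV[R]_d -> R)
    (x : 'rV[R]_d) :
  0 < M -> quad_upper M g -> finf g \is a fin_num ->
  enorm (grad g x) ^+ 2 <= 2 * M * (g x - fine (finf g)).
Proof.
move=> M0 qg fg.
have := le_trans (fine_finf_le (x - M^-1 *: grad g x) fg) (qg _ _).
rewrite -scaleNr edotZr enormZ exprMn sqr_enorm real_normK ?num_real// => h.
set e := edot _ _ in h *; set m := fine _ in h *.
have {h} : m <= g x - e / (2 * M).
  apply: (le_trans h); rewrite le_eqVlt; apply/orP; left; apply/eqP.
  by field; rewrite gt_eqF.
by rewrite lerBrDr -lerBrDl ler_pdivrMr ?mulr_gt0// mulrC.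
Qed.

Lemma sps_max_le (R : realType) (d : nat) (c gammab : R) (g : 'rV[R]_d -> R)
    (x : 'rV[R]_d) :
  sps_max c gammab g x <= gammab.
Proof. by rewrite /sps_max; case: ifP => // _; rewrite ge_min lexx orbT. Qed.

(** The defining property of the Polyak step: it turns the quadratic term of the
    descent lemma into a function gap. *)
Lemma sps_max_sqr_enorm_le (R : realType) (d : nat) (c gammab : R)
    (g : 'rV[R]_d -> R) (x : 'rV[R]_d) :
  0 < c -> finf g \is a fin_num ->
  sps_max c gammab g x * (c * enorm (grad g x) ^+ 2) <= g x - fine (finf g).
Proof.
move=> c0 fg; rewrite /sps_max; case: ifPn => [/eqP->|g0].
  by rewrite enorm0 expr0n/= !mulr0 subr_ge0 fine_finf_le.
by rewrite -ler_pdivlMr ?mulr_gt0 ?exprn_gt0 ?enorm_gt0// ge_min lexx.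
Qed.

Lemma le_sps_max (R : realType) (d : nat) (c gammab M : R)
    (g : 'rV[R]_d -> R) (x : 'rV[R]_d) :
  0 < c -> 0 < M -> quad_upper M g -> finf g \is a fin_num ->
  Num.min (1 / (2 * c * M)) gammab <= sps_max c gammab g x.
Proof.
move=> c0 M0 qg fg; rewrite /sps_max; case: ifPn => [_|g0].
  by rewrite ge_min lexx orbT.
rewrite le_min [X in _ && X]ge_min lexx orbT andbT ge_min; apply/orP; left.
rewrite ler_pdivlMr ?mulr_gt0 ?exprn_gt0 ?enorm_gt0//.
rewrite mul1r ler_pdivrMl ?mulr_gt0// (mulrC 2) -!mulrA ler_pM2l// mulrA.
exact: sqr_enorm_grad_le.
Qed.

(** Each term of [sigma2] is nonnegative and different from [-oo], so an infinite
    one would make the sum infinite. *)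
Lemma sigma2_fin_num_finf (R : realType) (d n : nat)
    (f : 'I_n.+1 -> 'rV[R]_d -> R) (xs : 'rV[R]_d) (i : 'I_n.+1) :
  sigma2 f xs \is a fin_num -> finf (f i) \is a fin_num.
Proof.
rewrite /sigma2 => fs.
have gap_ge0 j : (0 <= (f j xs)%:E - finf (f j))%E.
  by rewrite subre_ge0 ?finf_le.
have fsum : (\sum_(j < n.+1) ((f j xs)%:E - finf (f j)))%E \is a fin_num.
  rewrite ge0_fin_numE ?sume_ge0// ltNge leye_eq; apply/negP => /eqP s.
  by move: fs; rewrite s mulry gtr0_sg ?invr_gt0 ?ltr0n// mul1e.
have : ((f i xs)%:E - finf (f i))%E \is a fin_num.
  move: fsum; rewrite !ge0_fin_numE ?sume_ge0//; apply: le_lt_trans.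
  by rewrite (bigD1 i)//= leeDl// sume_ge0.
by rewrite fin_numD fin_numN => /andP[].
Qed.

Lemma sigma2E (R : realType) (d n : nat)
    (f : 'I_n.+1 -> 'rV[R]_d -> R) (xs : 'rV[R]_d) :
  (forall i, finf (f i) \is a fin_num) ->
  sigma2 f xs =
    (n.+1%:R^-1 * \sum_(i < n.+1) (f i xs - fine (finf (f i))))%:E.
Proof.
move=> ff; rewrite /sigma2 EFinM -sumEFin; congr (_ * _)%E.
by apply: eq_bigr => i _; rewrite EFinB fineK.
Qed.

(** * One iteration *)

(** The scalar core of one iteration, to be read with [ga] the step-size, [e] and
    [e'] the gaps of the average function before and after the step, [D] the inner
    product of its gradient with the sampled one, [G] the squared norm of the
    latter and [r] the gap of the sampled function to its infimum. Dividing by the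
    step-size [ga] leaves [D] with coefficient one, so that its mean can be taken
    although [ga] depends on the sample. *)
Lemma step_gap_le (R : realType) (al ga gb c M e e' D G r : R) :
  0 < al -> al <= ga -> ga <= gb -> 0 < c -> 0 <= M -> 0 <= e -> 0 <= e' ->
  ga * (c * G) <= r -> e' <= e - ga * D + M / 2 * (ga ^+ 2 * G) ->
  e' <= gb * (e / al - D + M / (2 * c) * r).
Proof.
move=> al0 alga gagb c0 M0 e0 e'0 hr he.
have ga0 : 0 < ga := lt_le_trans al0 alga.
have he' : e' <= ga * (e / al - D + M / (2 * c) * r).
  apply: (le_trans he); rewrite !(mulrDr ga) mulrN lerD ?lerD2r//.
    by rewrite mulrA ler_pdivlMr// mulrC ler_wpM2r.
  have -> : M / 2 * (ga ^+ 2 * G) = ga * (M / (2 * c) * (ga * (c * G))).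
    by field; rewrite gt_eqF.
  by rewrite ler_pM2l// ler_wpM2l// divr_ge0// mulr_ge0// ltW.
by apply: (le_trans he'); rewrite ler_wpM2r// -(pmulr_rge0 _ ga0) (le_trans e'0).
Qed.

(** One iteration from a fixed point [x], averaged over the index. *)
Lemma mean_sgd_step_le (R : realType) (d n : nat)
    (f : 'I_n.+1 -> 'rV[R]_d -> R) (xs x : 'rV[R]_d)
    (mu M Lmax c gammab : R) :
  is_minimizer (favg f) xs ->
  polyak_lojasiewicz mu (favg f) (favg f xs) ->
  (forall i x, differentiable (f i) x) ->
  (forall i, quad_upper Lmax (f i)) -> quad_upper M (favg f) ->
  (forall i, finf (f i) \is a fin_num) ->
  0 <= M -> 0 < Lmax -> 0 < c -> 0 < gammab ->
  n.+1%:R^-1 * \sum_(i < n.+1)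
    (favg f (x - sps_max c gammab (f i) x *: grad (f i) x) - favg f xs)
  <= gammab * (1 / Num.min (1 / (2 * c * Lmax)) gammab - 2 * mu + M / (2 * c))
       * (favg f x - favg f xs)
     + gammab * (M / (2 * c)) * fine (sigma2 f xs).
Proof.
move=> hmin hPL df qf qF fi M0 Lmax0 c0 gb0.
rewrite sigma2E//=; set al := Num.min _ _.
set F := favg f; set e := F x - F xs.
have n0 : n.+1%:R != 0 :> R by rewrite pnatr_eq0.
have al0 : 0 < al by rewrite lt_min gb0 divr_gt0 ?mulr_gt0.
have step i : F (x - sps_max c gammab (f i) x *: grad (f i) x) - F xs <=
    gammab * (e / al - edot (grad F x) (grad (f i) x)
              + M / (2 * c) * (f i x - fine (finf (f i)))).
  apply: (step_gap_le (ga := sps_max c gammab (f i) x)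
            (G := enorm (grad (f i) x) ^+ 2)) => //; rewrite ?subr_ge0//.
  - exact: le_sps_max.
  - exact: sps_max_le.
  - exact: sps_max_sqr_enorm_le.
  - rewrite lerBlDr; apply: (le_trans (qF _ _)).
    rewrite -scaleNr edotZr enormZ exprMn real_normK ?num_real// sqrrN.
    by rewrite le_eqVlt /e -/F; apply/orP; left; apply/eqP; ring.
have mean_cst (a : R) : n.+1%:R^-1 * \sum_(i < n.+1) a = a.
  by rewrite sumr_const card_ord -[a *+ _]mulr_natl mulKf.
have mean_gap : n.+1%:R^-1 * \sum_(i < n.+1) (f i x - fine (finf (f i)))
    = e + n.+1%:R^-1 * \sum_(i < n.+1) (f i xs - fine (finf (f i))).
  rewrite /e /F /favg !sumrB; ring.
apply: (@le_trans _ _ (n.+1%:R^-1 * \sum_(i < n.+1)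
    gammab * (e / al - edot (grad F x) (grad (f i) x)
              + M / (2 * c) * (f i x - fine (finf (f i)))))).
  by rewrite ler_wpM2l ?invr_ge0// ler_sum.
rewrite -mulr_sumr mulrCA big_split sumrB/=.
rewrite -[X in _ + X]mulr_sumr mulrDr mulrBr mean_cst.
under [X in _ - _ * X]eq_bigr do rewrite edotC.
rewrite -edot_grad_favg// -/F -sqr_enorm mulrCA mean_gap; set s := n.+1%:R^-1 * _.
rewrite -(mulrA gammab _ e) -(mulrA gammab _ s) -mulrDr ler_pM2l//.
have := hPL x; rewrite -/F -/e div1r; move: (enorm _ ^+ 2) => G hG.
have -> : e / al - G + M / (2 * c) * (e + s) =
   (al^-1 - 2 * mu + M / (2 * c)) * e + M / (2 * c) * s + (2 * mu * e - G).
  by ring.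
by rewrite mulrA gerDl subr_le0.
Qed.

(** * Expectation over the indices *)

Lemma sgd_eq_prefix (R : realType) (d n : nat) (f : 'I_n -> 'rV[R]_d -> R)
    (c gammab : R) (x0 : 'rV[R]_d) (a b : nat -> 'I_n) (k : nat) :
  (forall j, (j < k)%N -> a j = b j) ->
  sgd f c gammab x0 a k = sgd f c gammab x0 b k.
Proof.
elim: k => //= k IH ab; rewrite IH ?ab// => j jk.
by rewrite ab// (ltn_trans jk).
Qed.

Lemma expectation_fin (R : realType) (disp : measure_display)
    (T : measurableType disp) (P : probability T R) (F : finType)
    (S : T -> F) (G : F -> R) :
  (forall s, measurable (S @^-1` [set s])) ->
  ('E_P[fun w => G (S w)] = \sum_(s : F) (G s)%:E * P (S @^-1` [set s]))%E.
Proof.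
move=> mS; rewrite unlock.
under eq_integral => w _.
  have -> : (G (S w))%:E = (\sum_(s : F) (G s)%:E * (\1_(S @^-1` [set s]) w)%:E)%E.
    rewrite (bigD1 (S w))//= big1 ?adde0 => [|s sw].
      by rewrite indicE mem_set// mule1.
    by rewrite indicE memNset ?mule0// => /= e; rewrite e eqxx in sw.
  over.
have iS (s : F) : P.-integrable setT (fun w => (\1_(S @^-1` [set s]) w)%:E).
  exact: integrable_indic.
rewrite integral_sum//=; last by move=> s; exact: integrableZl.
by apply: eq_bigr => s _; rewrite integralZl// integral_indic// setIT.
Qed.

(** The law of the first [m] indices is uniform: if a finitely valued [S] encodes
    them through [D], each of its values has probability [n.+1%:R^-1 ^+ m]. *)
Lemma expectation_prefix (R : realType) (disp : measure_display)
    (T : measurableType disp) (P : probability T R) (n m : nat)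
    (idx : nat -> T -> 'I_n.+1) (F : finType) (S : T -> F)
    (D : F -> nat -> 'I_n.+1) (G : F -> R) :
  (forall k, uniform_index P (idx k)) -> mutually_independent P idx ->
  (forall w s, S w = s <-> forall j, (j < m)%N -> idx j w = D s j) ->
  ('E_P[fun w => G (S w)] = (n.+1%:R^-1 ^+ m * \sum_(s : F) G s)%:E)%E.
Proof.
move=> hunif hindep SD.
have fiberE s : S @^-1` [set s] =
    \bigcap_(j in [set` iota 0 m]) (idx j @^-1` [set D s j]).
  apply/seteqP; split => w /=.
    by move=> /SD h j /=; rewrite mem_iota add0n => /h.
  by move=> h; apply/SD => j jm; apply: h => /=; rewrite mem_iota.
rewrite expectation_fin => [|s]; last first.
  rewrite fiberE; apply: bigcap_measurableType => j _.
  by case: (hunif j (D s j)).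
rewrite mulr_sumr -sumEFin; apply: eq_bigr => s _.
rewrite EFinM muleC fiberE hindep ?iota_uniq//; congr (_ * _)%E.
under eq_bigr do rewrite (hunif _ _).2.
elim: m {SD fiberE} 0%N => [|m IH] a /=; first by rewrite big_nil expr0.
by rewrite big_cons IH exprS EFinM.
Qed.

(** A bound on the one-step averages of [h] that holds at every point passes to
    the expectation of [h] along the iterates: the current index is independent of
    the previous ones, hence of the current point. *)
Lemma expectation_sgd_le (R : realType) (d n : nat)
    (f : 'I_n.+1 -> 'rV[R]_d -> R) (c gammab : R) (x0 : 'rV[R]_d)
    (disp : measure_display) (T : measurableType disp) (P : probability T R)
    (idx : nat -> T -> 'I_n.+1) (h : 'rV[R]_d -> R) (nu N : R) (k : nat) :
  (forall k, uniform_index P (idx k)) -> mutually_independent P idx ->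
  0 <= nu ->
  (forall x, n.+1%:R^-1 * \sum_(i < n.+1)
     h (x - sps_max c gammab (f i) x *: grad (f i) x) <= nu * h x + N) ->
  ('E_P[fun w => h (sgd f c gammab x0 (fun j => idx j w) k)]
   <= (nu ^+ k * h x0 + N * \sum_(j < k) nu ^+ j)%:E)%E.
Proof.
move=> hunif hindep nu0 step.
pose p : R := n.+1%:R^-1.
pose xt k (t : k.-tuple 'I_n.+1) := sgd f c gammab x0 (nth ord0 t) k.
pose pre k w : k.-tuple 'I_n.+1 := [tuple idx j w | j < k].
have preE j m w i : (j < m)%N -> nth i (pre m w) j = idx j w.
  by move=> jm; rewrite -[j]/(val (Ordinal jm)) -tnth_nth tnth_mktuple.
have sgdE m w : sgd f c gammab x0 (fun j => idx j w) m = xt m (pre m w).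
  by apply: sgd_eq_prefix => j jm; rewrite preE.
have preP m w (t : m.-tuple 'I_n.+1) i :
    (forall j, (j < m)%N -> idx j w = nth i t j) -> pre m w = t.
  by move=> E; apply: eq_from_tnth => j; rewrite tnth_mktuple E// (tnth_nth i).
have EkE m : ('E_P[fun w => h (sgd f c gammab x0 (fun j => idx j w) m)]
    = (p ^+ m * \sum_(t : m.-tuple 'I_n.+1) h (xt m t))%:E)%E.
  rewrite -(expectation_prefix (S := pre m) (D := fun t j => nth ord0 t j)
      (fun t => h (xt m t)) hunif hindep).
    by congr expectation; apply/funext => w; rewrite sgdE.
  by move=> w t; split => [<- j jm|/preP//]; rewrite preE.
have EkSE m : ('E_P[fun w => h (sgd f c gammab x0 (fun j => idx j w) m.+1)]
    = (p ^+ m * \sum_(t : m.-tuple 'I_n.+1) (p * \sum_(i < n.+1)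
        h (xt m t - sps_max c gammab (f i) (xt m t) *: grad (f i) (xt m t))))%:E)%E.
  rewrite -mulr_sumr mulrA -exprSr pair_bigA/=.
  (* The pair of the first [m] indices and the next one encodes [m.+1] indices;
     reading a tuple past its end returns the default value. *)
  rewrite -(expectation_prefix (S := fun w => (pre m w, idx m w))
      (D := fun ti j => nth ti.2 ti.1 j) (fun ti =>
        h (xt m ti.1 - sps_max c gammab (f ti.2) (xt m ti.1)
                       *: grad (f ti.2) (xt m ti.1))) hunif hindep).
    by congr expectation; apply/funext => w /=; rewrite sgdE.
  move=> w [t i]; split => /= [[<- <-] j|E].
    rewrite ltnS leq_eqVlt => /orP[/eqP->|jm]; last by rewrite preE.
    by rewrite nth_default// size_tuple.
  congr pair; first by apply: (preP _ _ _ i) => j jm; apply/E/leqW.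
  by rewrite E// nth_default// size_tuple.
elim: k => [|k IH].
  by rewrite big_ord0 mulr0 addr0 expr0 mul1r /= expectation_cst.
move: IH; rewrite EkSE EkE !lee_fin => IH.
have pk0 : 0 <= p ^+ k by rewrite exprn_ge0// invr_ge0.
apply: (@le_trans _ _
    (p ^+ k * \sum_(t : k.-tuple 'I_n.+1) (nu * h (xt k t) + N))).
  by rewrite ler_wpM2l// ler_sum.
rewrite big_split/= -mulr_sumr sumr_const card_tuple card_ord mulrDr mulrCA.
have -> : p ^+ k * (N *+ n.+1 ^ k) = N.
  by rewrite -mulr_natr natrX mulrCA -exprMn mulVf ?expr1n ?mulr1// pnatr_eq0.
rewrite (le_trans (lerD (ler_wpM2l nu0 IH) (lexx N)))// big_ord_recl expr0.
under [X in _ <= _ + N * (_ + X)]eq_bigr do rewrite exprS.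
rewrite -mulr_sumr exprS le_eqVlt; apply/orP; left; apply/eqP; ring.
Qed.

(** * Noise term and conclusion *)

(** The geometric sum of the noise terms. For [nu = 1] the quotient is [+oo] if
    [0 < q] and [0] if [q = 0]. *)
Lemma geometric_noise_le (R : realType) (nu q c : R) (k : nat) :
  0 <= nu -> nu <= 1 -> 0 < c -> 0 <= q ->
  ((q / (2 * c) * \sum_(j < k) nu ^+ j)%:E <= q%:E / (2 * (1 - nu) * c)%:E)%E.
Proof.
move=> nu0 + c0; rewrite le_eqVlt => /orP[/eqP->|nu1].
  rewrite le_eqVlt => /orP[/eqP<-|q0]; first by rewrite !mul0r mul0e.
  by rewrite subrr mulr0 mul0r inve0 gt0_muley ?lte_fin// leey.
have nu1' : 0 < 1 - nu by rewrite subr_gt0.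
move=> q0; rewrite inver gt_eqF ?mulr_gt0// -EFinM lee_fin.
have -> : q / (2 * (1 - nu) * c) = q / (2 * c) * (1 - nu)^-1.
  by field; rewrite !gt_eqF.
apply: ler_wpM2l; first by rewrite divr_ge0// mulr_ge0// ltW.
rewrite -(mul1r (1 - nu)^-1) ler_pdivlMr// mulrC -(opprB nu 1) mulNr -subrX1.
by rewrite opprB gerBl exprn_ge0.
Qed.

(** A negative Lipschitz constant forces the space to be a point, where every
    function attains its infimum. *)
Lemma sigma2_lt0_smooth (R : realType) (d n : nat) (L : R)
    (f : 'I_n.+1 -> 'rV[R]_d -> R) (g : 'rV[R]_d -> R) (xs : 'rV[R]_d) :
  L < 0 -> smooth L g -> sigma2 f xs = 0%E.
Proof.
move=> L0 [_ lg].
have pt x : x = xs.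
  apply/eqP; rewrite -subr_eq0; apply/negPn/negP => /enorm_gt0 h.
  have := le_trans (enorm_ge0 _) (lg x xs).
  by rewrite nmulr_rge0// leNgt h.
rewrite /sigma2 big1 ?mule0// => i _.
suff -> : finf (f i) = (f i xs)%:E by rewrite subee.
rewrite /finf -[RHS]ereal_inf1; congr ereal_inf.
apply/seteqP; split => [_ [x _ <-]|_ ->]/=; last by exists xs.
by rewrite (pt x).
Qed.

(* There are n.+1 functions f_i, so that Lmax is the max of a nonempty family.
   The bound is an extended real: when nu = 1 the last quotient has denominator
   0, and a^-1 = +oo for a = 0 in \bar R. *)
Theorem theorem3p6 (R : realType) (d n : nat)
    (f : 'I_n.+1 -> 'rV[R]_d -> R) (xs x0 : 'rV[R]_d)
    (mu L c gammab Lmax alpha nu : R) (Li : 'I_n.+1 -> R)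
    (disp : measure_display) (T : measurableType disp) (P : probability T R)
    (idx : nat -> T -> 'I_n.+1)
    (hmin : is_minimizer (favg f) xs)
    (hsigma : sigma2 f xs \is a fin_num)
    (hmu : 0 < mu)
    (hPL : polyak_lojasiewicz mu (favg f) (favg f xs))
    (hL : smooth L (favg f))
    (hLi : forall i, smooth (Li i) (f i))
    (hLmax : Lmax = \big[Num.max/Li ord0]_(i < n.+1) Li i)
    (hc0 : 0 < c) (hc : Lmax / (4 * mu) < c)
    (hgammab0 : 0 < gammab) (hgammab : 1 / (2 * c * Lmax) <= gammab)
    (halpha : alpha = Num.min (1 / (2 * c * Lmax)) gammab)
    (hnu : nu = gammab * (1 / alpha - 2 * mu + Lmax / (2 * c)))
    (hnu01 : 0 < nu <= 1)
    (hunif : forall k, uniform_index P (idx k))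
    (hindep : mutually_independent P idx)
    (k : nat) :
  ('E_P[fun w => (favg f (sgd f c gammab x0 (fun j => idx j w) k) - favg f xs)%R]
   <= (nu ^+ k * (favg f x0 - favg f xs))%:E
      + L%:E * sigma2 f xs * gammab%:E / (2 * (1 - nu) * c)%:E)%E.
Proof.
have fi i : finf (f i) \is a fin_num := sigma2_fin_num_finf i hsigma.
have Lmax0 : 0 < Lmax.
  rewrite ltNge; apply/negP => Lmax0; case/andP: hnu01 => nu0 _; move: nu0.
  have inv0 : 1 / (2 * c * Lmax) <= 0.
    by rewrite div1r invr_le0 mulr_ge0_le0// mulr_ge0// ltW.
  have al0 : alpha <= 0 by rewrite halpha ge_min inv0.
  rewrite hnu pmulr_rgt0// ltNge; apply/negP; rewrite negbK.
  have : 1 / alpha <= 0 by rewrite div1r invr_le0.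
  have : Lmax / (2 * c) <= 0 by rewrite pmulr_lle0// invr_gt0 mulr_gt0.
  by move: hmu; lra.
have df i x : differentiable (f i) x by case: (hLi i).
have qf i : quad_upper Lmax (f i).
  apply: quad_upper_le (smooth_quad_upper (hLi i)).
  by rewrite hLmax; exact: le_bigmax.
(* [L] need not be the best constant of the average: [Lmax] is another one, and
   the contraction factor requires the smaller of the two. *)
pose M := Num.max 0 (Num.min L Lmax).
have M0 : 0 <= M by rewrite le_max lexx.
have qF : quad_upper M (favg f).
  apply: (@quad_upper_le _ _ (Num.min L Lmax)); first by rewrite le_max lexx orbT.
  rewrite /Num.min; case: ifP => _; first exact: smooth_quad_upper.
  exact: quad_upper_favg.
have MLmax : M <= Lmax by rewrite ge_max ltW//= ge_min lexx orbT.
have s20 : 0 <= fine (sigma2 f xs).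
  rewrite sigma2E//= mulr_ge0 ?invr_ge0// sumr_ge0// => i _.
  by rewrite subr_ge0 fine_finf_le.
have ML : M * fine (sigma2 f xs) <= L * fine (sigma2 f xs).
  have [L0|L0] := leP 0 L.
    by rewrite ler_wpM2r// ge_max L0 ge_min lexx.
  by rewrite (sigma2_lt0_smooth f xs L0 hL)/= !mulr0.
set q := L * fine (sigma2 f xs) * gammab.
have q0 : 0 <= q.
  by rewrite mulr_ge0 ?(ltW hgammab0)// (le_trans _ ML)// mulr_ge0.
have [nu0 nu1] := andP hnu01.
have -> : (L%:E * sigma2 f xs * gammab%:E = q%:E)%E.
  by rewrite -(fineK hsigma).
have step x : n.+1%:R^-1 * \sum_(i < n.+1)
    (favg f (x - sps_max c gammab (f i) x *: grad (f i) x) - favg f xs)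
    <= nu * (favg f x - favg f xs) + q / (2 * c).
  have := mean_sgd_step_le x hmin hPL df qf qF fi M0 Lmax0 hc0 hgammab0.
  move/le_trans; apply; rewrite -halpha; apply: lerD.
    rewrite ler_wpM2r ?subr_ge0// hnu ler_wpM2l ?(ltW hgammab0)// lerD2l.
    by rewrite ler_wpM2r// invr_ge0 mulr_ge0// ltW.
  have -> : gammab * (M / (2 * c)) * fine (sigma2 f xs)
          = M * fine (sigma2 f xs) * gammab / (2 * c) by ring.
  by rewrite ler_wpM2r ?(ler_wpM2r (ltW hgammab0))// invr_ge0 mulr_ge0// ltW.
have := expectation_sgd_le (h := fun x => favg f x - favg f xs) x0 k
  hunif hindep (ltW nu0) step.
move/le_trans; apply; rewrite EFinD leeD2l//.
exact: geometric_noise_le (ltW nu0) nu1 hc0 q0.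
Qed.
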